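(* Let $n>1$, $d\ge 2$ and $t$ be integers with $\gcd(t,d)=1$, $n\equiv t\pmod d$ and $n+d-nd\le t\le n$. Then \[ \sum_{k=0}^{(n-t)/d}[2dk+t]\frac{(q^t;q^d)_k^4}{(q^d;q^d)_k^4}q^{(d-2t)k}\equiv \frac{(q^{2t};q^d)_{(n-t)/d}}{(q^d;q^d)_{(n-t)/d}}[n]\,q^{t(t-n)/d}\pmod{[n]\Phi_n(q)^2}, \] and \[ \sum_{k=0}^{n-1}[2dk+t]\frac{(q^t;q^d)_k^4}{(q^d;q^d)_k^4}q^{(d-2t)k}\equiv \frac{(q^{2t};q^d)_{(n-t)/d}}{(q^d;q^d)_{(n-t)/d}}[n]\,q^{t(t-n)/d}\pmod{[n]\Phi_n(q)^2}. \]
   Context: For an indeterminate $q$, $(x;q)_k=(1-x)(1-xq)\cdots(1-xq^{k-1})$ (with $(x;q)_0=1$). For any integer $m$, $[m]=(1-q^m)/(1-q)$. $\Phi_n(q)$ is the $n$-th cyclotomic polynomial. A congruence $A\equiv B\pmod{P(q)}$ between rational functions in $q$ means that $A-B$, written as a quotient of polynomials with denominator coprime to $P(q)$, has numerator divisible by $P(q)$. *)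

(* Defs.v *)
From HB Require Import structures.
From mathcomp Require Import all_boot all_order all_algebra all_field.
Set Implicit Arguments. Unset Strict Implicit. Unset Printing Implicit Defensive.
Import Order.TTheory GRing.Theory Num.Theory.
Local Open Scope ring_scope.

Definition RF := {fraction {poly rat}}.

Definition pfrac (p : {poly rat}) : RF := @FracField.tofrac _ p.

Definition qF : RF := pfrac 'X.

Definition qpow (z : int) : RF := qF ^ z.

Definition qpoch (x a : RF) (k : nat) : RF := \prod_(i < k) (1 - x * a ^+ i).

Definition qint (m : int) : RF := (1 - qpow m) / (1 - qF).

Definition qint_poly (n : nat) : {poly rat} := \sum_(i < n) 'X^i.

Definition Phi (n : nat) : {poly rat} := map_poly intr ('Phi_n).

Definition qcong (A B : RF) (P : {poly rat}) : Prop :=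
  exists N D : {poly rat},
    [/\ D != 0, coprimep D P, P %| N & A - B = pfrac N / pfrac D].

(* Main.v *)
(** Write [a = q^t], [p = q^d] and [m = (n-t)/d], so that [a p^m = q^n]. Replacing two of
    the four factors [(a;p)_k/(p;p)_k] by [(a q^n;p)_k (a q^-n;p)_k/((p q^n;p)_k (p q^-n;p)_k)]
    gives a terminating 6phi5 series whose sum is exactly the right-hand side. The
    two series differ by a deformation in [x = (1-q^n)^2/q^n], which is divisible
    by [Phi_n^2]; so modulo [Phi_n^3] only the linear term in [x] matters. Its
    coefficient is divisible by [Phi_n] since, at a primitive [n]-th root of unity,
    the summands are antisymmetric under [k -> m - k] while the first-order
    corrections are symmetric.

    For a divisor [1 < e < n] of [n], the summand at index [l e + j] takes at a
    primitive [e]-th root of unity the value of the [j]-th summand times a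
    constant depending on [l] only, and the same antisymmetry makes each block
    of length [e], and the incomplete block ending at [m], sum to zero. *)
Require Import Defs.
From HB Require Import structures.
From mathcomp Require Import all_boot all_order all_algebra all_field.
From mathcomp Require Import ring zify.
Import Order.TTheory GRing.Theory Num.Theory.
Local Open Scope ring_scope.

Set Implicit Arguments. Unset Strict Implicit. Unset Printing Implicit Defensive.

(** * The terminating very-well-poised 6phi5 sum *)

Section Poch.
Variable F : fieldType.
Implicit Types x a b c p : F.

Definition poch (x p : F) (k : nat) : F := \prod_(i < k) (1 - x * p ^+ i).

Lemma poch0 x p : poch x p 0 = 1.
Proof. by rewrite /poch big_ord0. Qed.

Lemma pochSr x p k : poch x p k.+1 = poch x p k * (1 - x * p ^+ k).
Proof. by rewrite /poch big_ord_recr. Qed.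

Lemma pochD x p k l : poch x p (k + l) = poch x p k * poch (x * p ^+ k) p l.
Proof.
by rewrite /poch big_split_ord /=; congr (_ * _); apply: eq_bigr => i _; rewrite exprD mulrA.
Qed.

Lemma pochS x p k : poch x p k.+1 = (1 - x) * poch (x * p) p k.
Proof. by rewrite -add1n pochD expr1 pochSr poch0 mul1r expr0 mulr1. Qed.

Lemma poch_neq0 x p k :
  (forall i, (i < k)%N -> 1 - x * p ^+ i != 0) -> poch x p k != 0.
Proof. by move=> nz; apply/prodf_neq0 => i _; apply: nz. Qed.

Lemma poch_eq0 x p k i : (i < k)%N -> x * p ^+ i = 1 -> poch x p k = 0.
Proof.
by move=> ik e; apply/eqP/prodf_eq0; exists (Ordinal ik); rewrite //= e subrr.
Qed.

(** Bridges nonvanishing hypotheses stated with quotients and the cleared denominators that [field]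
    produces. *)
Lemma subr_neq0_of_div x y z : x != 0 -> 1 - y / x * z != 0 -> x - y * z != 0.
Proof.
move=> x0; apply: contraNneq => e.
have -> : 1 - y / x * z = x^-1 * (x - y * z) by field.
by rewrite e mulr0.
Qed.

(** Summand of the terminating very-well-poised 6phi5 series. *)
Definition vwp65_term a b c p m k : F :=
  (1 - a * p ^+ k ^+ 2)
  * (poch a p k * poch b p k * poch c p k * poch (p ^- m) p k
     / (poch p p k * poch (a * p / b) p k * poch (a * p / c) p k * poch (a * p ^+ m.+1) p k))
  * (a * p ^+ m.+1 / (b * c)) ^+ k.

Section Sum65.
Variables a b c p : F.
Hypotheses (p0 : p != 0) (b0 : b != 0) (c0 : c != 0).
Hypothesis a_nz : forall i, 1 - a * p ^+ i != 0.
Hypothesis p_nz : forall i, 1 - p * p ^+ i != 0.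
Hypothesis b_nz : forall i, 1 - a * p / b * p ^+ i != 0.
Hypothesis c_nz : forall i, 1 - a * p / c * p ^+ i != 0.

(** The right-hand side is the Wilf-Zeilberger companion of the recurrence
    in [m] satisfied by the sum of the [vwp65_term]s. *)
Lemma vwp65_partial m k :
  \sum_(i < k.+1)
     ((1 - a * p ^+ m.+1 / b) * (1 - a * p ^+ m.+1 / c) * vwp65_term a b c p m.+1 i
      - (1 - a * p ^+ m.+1) * (1 - a * p ^+ m.+1 / (b * c)) * vwp65_term a b c p m i)
  = poch a p k.+1 * poch b p k.+1 * poch c p k.+1 * poch (p ^- m) p k
     / (poch p p k * poch (a * p / b) p k * poch (a * p / c) p k * poch (a * p ^+ m.+2) p k)
    * (a * p ^+ m.+1 / (b * c)) ^+ k.+1.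
Proof.
elim: k => [|k IH].
  rewrite big_ord1 /vwp65_term !pochSr !poch0 !expr0 !expr1.
  by field; rewrite b0 c0 oner_neq0.
rewrite big_ord_recr IH /= /vwp65_term.
have nz x : (forall i, 1 - x * p ^+ i != 0) -> forall j, poch x p j != 0.
  by move=> h j; apply: poch_neq0.
have am_nz j i : 1 - a * p ^+ j * p ^+ i != 0 by rewrite -mulrA -exprD.
have := nz _ p_nz k; have := nz _ b_nz k; have := nz _ c_nz k.
have := nz _ (am_nz m.+2) k.
have := am_nz m.+2 k; have := a_nz m.+1; have := p_nz k; have := b_nz k; have := c_nz k.
rewrite (pochSr p) (pochSr (a * p / b)) (pochSr (a * p / c)) (pochS (a * p ^+ m.+1)).
rewrite (pochSr a p k.+1) (pochSr b p k.+1) (pochSr c p k.+1).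
rewrite (pochS (p ^- m.+1)) (pochSr (p ^- m)) (pochSr (a * p ^+ m.+2)).
have -> : p ^- m.+1 * p = p ^- m by rewrite exprS; field; rewrite p0 expf_neq0.
have -> : a * p ^+ m.+1 * p = a * p ^+ m.+2 by rewrite (exprSr p m.+1) mulrA.
have -> : (a * p ^+ m.+2 / (b * c)) ^+ k.+1
          = (a * p ^+ m.+1 / (b * c)) ^+ k.+1 * (p * p ^+ k).
  rewrite -exprS -exprMn (exprSr p m.+1). congr (_ ^+ _); field.
  by rewrite b0 c0.
rewrite (exprSr (a * p ^+ m.+1 / (b * c)) k.+1).
move: ((a * p ^+ m.+1 / (b * c)) ^+ k.+1) => z.
have := expf_neq0 k p0; have := expf_neq0 m p0.
rewrite !expr2 !exprS.
move: (poch a _ _) (poch b _ _) (poch c _ _) (poch p _ _) (poch (p ^- m) _ _)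
  (poch (a * p / b) _ _) (poch (a * p / c) _ _) (poch (a * (p * (p * p ^+ m))) _ _)
  => xa xb xc xp xm yb yc ym.
move: (p ^+ m) (p ^+ k) => M P.
move=> M0 P0 h1 h2 h3 h4 h5 ym0 yc0 yb0 xp0.
field.
by rewrite h3 h4 h5 !(subr_neq0_of_div (x := c), subr_neq0_of_div (x := b)) // b0 c0 p0 M0 ym0 yb0 yc0 xp0.
Qed.

(** Rogers' terminating 6phi5 sum, multiplied by [1 - a] because the summand keeps [1 - a p^(2k)]
    undivided. *)
Lemma vwp65_sum m :
  \sum_(k < m.+1) vwp65_term a b c p m k
  = (1 - a) * poch (a * p) p m * poch (a * p / (b * c)) p m
    / (poch (a * p / b) p m * poch (a * p / c) p m).
Proof.
have pm0 j i : (j < i)%N -> poch (p ^- j) p i = 0.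
  by move=> ji; apply: (poch_eq0 ji); rewrite mulVf ?expf_neq0.
elim: m => [|m IH].
  by rewrite big_ord1 /vwp65_term /= !poch0 !expr0 !expr1n !mulr1 invr1 !mulr1.
(* The companion now contains [poch (p ^- m) p m.+1], which is zero, so the summed identity becomes
   a first-order recurrence in [m]. *)
have := vwp65_partial m m.+1.
rewrite pm0 // mulr0 !mul0r big_split /= sumrN -!mulr_sumr.
rewrite [X in _ - _ * X]big_ord_recr /= IH {2}/vwp65_term pm0 // mulr0 mul0r mulr0 mul0r addr0.
have sh x : a * p ^+ m.+1 / x = a * p / x * p ^+ m by rewrite exprS; ring.
have bm := b_nz m; have cm := c_nz m.
have := @poch_neq0 (a * p / b) p m (fun i _ => b_nz i).
have := @poch_neq0 (a * p / c) p m (fun i _ => c_nz i).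
have sh1 : a * p ^+ m.+1 = a * p * p ^+ m by rewrite exprS mulrA.
rewrite !pochSr !sh sh1 => yc0 yb0 /eqP.
rewrite subr_eq0 => /eqP e; apply: (mulfI (mulf_neq0 bm cm)); rewrite e.
move: yc0 yb0 bm cm.
move: (poch _ _ _) (poch _ _ _) (poch _ _ _) (poch _ _ _) (p ^+ m) => x1 x2 x3 x4 M.
move=> yc0 yb0 bm cm; field.
by rewrite b0 c0 yb0 yc0 !(subr_neq0_of_div (x := c), subr_neq0_of_div (x := b)).
Qed.

End Sum65.

(** Measures how [(1 - x N)(1 - x / N)] depends on [N]: it equals
    [(1 - x)^2 (1 - (1 - N)^2 / N * weight x)]. *)
Definition weight x : F := x / (1 - x) ^+ 2.

(** The summand of the theorem is [wterm a p k / (1 - q)] with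
    [a = q ^ t] and [p = q ^ d]. *)
Definition wterm a p k : F :=
  (1 - a * p ^+ k ^+ 2) * (poch a p k / poch p p k) ^+ 4 * (p / a ^+ 2) ^+ k.

Lemma poch_pair y p N k :
  N != 0 -> (forall i, 1 - y * p ^+ i != 0) ->
  poch (y * N) p k * poch (y / N) p k
  = poch y p k ^+ 2
    * \prod_(i < k) (1 - (1 - N) ^+ 2 / N * weight (y * p ^+ i)).
Proof.
move=> N0 nz; rewrite /poch -prodrXl -!big_split; apply: eq_bigr => i _ /=.
rewrite /weight; have := nz i; move: (p ^+ i) => P h.
by field; rewrite N0 h.
Qed.

(** After the reversal [i -> m - 1 - i] each factor reads [1 - (y p^i)^-1], which is [- (y p^i)^-1]
    times [1 - y p^i]. *)
Lemma poch_rev y p m : y != 0 -> p != 0 ->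
  poch (p / (y * p ^+ m)) p m = poch y p m * \prod_(i < m) - (y * p ^+ i)^-1.
Proof.
move=> y0 p0; rewrite /poch (reindex_inj rev_ord_inj) -big_split.
apply: eq_bigr => i _ /=; have P0 := expf_neq0 i p0.
have P1 := expf_neq0 (m - i.+1) p0.
rewrite -[in y * p ^+ m](subnKC (ltn_ord i)) exprD exprS.
by field; rewrite y0 p0 P0 P1.
Qed.

(** The 6phi5 sum with [b = a] and [c = a N], where [N = a p ^ m = q ^ n].
    The factors containing [N] and [1 / N] pair up, so that the series is a
    deformation of the one with four equal parameters, of size [x]. *)
Lemma sum_deformed_wterm a p m :
  a != 0 -> p != 0 ->
  (forall i, 1 - a * p ^+ i != 0) -> (forall i, 1 - p * p ^+ i != 0) ->
  (forall i, 1 - p / (a * p ^+ m) * p ^+ i != 0) ->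
  let x := (1 - a * p ^+ m) ^+ 2 / (a * p ^+ m) in
  \sum_(k < m.+1) (wterm a p k
     * (\prod_(i < k) (1 - x * weight (a * p ^+ i))
        / \prod_(i < k) (1 - x * weight (p * p ^+ i))))
  = (1 - a * p ^+ m) * (poch (a ^+ 2) p m / poch p p m) / a ^+ m.
Proof.
move=> a0 p0 a_nz p_nz N_nz x.
have pm0 : p ^+ m != 0 by rewrite expf_neq0.
have N0 : a * p ^+ m != 0 by rewrite mulf_neq0.
have eb : a * p / a = p by field.
have ec : a * p / (a * (a * p ^+ m)) = p / (a * p ^+ m) by field; rewrite a0 pm0.
have ebc : a * p / (a * (a * (a * p ^+ m))) = p / (a * (a * p ^+ m)).
  by field; rewrite a0 pm0.
transitivity (\sum_(k < m.+1) vwp65_term a a (a * (a * p ^+ m)) p m k).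
  apply: eq_bigr => -[k _] _ /=.
  (* With [N = a p^m], the numerator pairs [a N] with [a / N = p^-m], and the denominator pairs
     [p N = a p^(m+1)] with [p / N]. *)
  have := poch_pair k N0 a_nz; have := poch_pair k N0 p_nz.
  have -> : a / (a * p ^+ m) = p ^- m by field; rewrite a0 pm0.
  rewrite /wterm /vwp65_term eb ec.
  have -> : p * (a * p ^+ m) = a * p ^+ m.+1 by rewrite exprS; ring.
  have -> : a * p ^+ m.+1 / (a * (a * (a * p ^+ m))) = p / a ^+ 2.
    by rewrite exprS; field; rewrite a0 pm0.
  move: (\prod_(i < k) _) (\prod_(i < k) _) => X Y eX eY.
  move: (poch a p k) (poch p p k) (poch (a * _) p k) (poch (p / _) p k) (poch (p ^- m) p k)
    (poch (a * p ^+ m.+1) p k) eX eY => xa xp xb yb xm ym eX eY.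
  have -> : xa * xa * xb * xm = xa ^+ 4 * X by rewrite -mulrA eY; ring.
  have -> : xp * xp * yb * ym = xp ^+ 4 * Y by rewrite -mulrA [yb * ym]mulrC eX; ring.
  by rewrite (expr_div_n xa) (invfM (xp ^+ 4)); move: (_ ^+ k) (_ ^-1) (_ ^-1) => z u v; ring.
rewrite vwp65_sum //; first last.
- by move=> i; rewrite ec.
- by move=> i; rewrite eb.
- by rewrite !mulf_neq0.
rewrite eb ec ebc -pochS pochSr.
have a2 : a ^+ 2 != 0 by rewrite expf_neq0.
rewrite [a * (a * _)]mulrA -expr2 !poch_rev //.
(* The monomials from the two reversals differ by one [a^-1] per index, which is the source of
   [a^-m] in the closed form. *)
rewrite (_ : \prod_(i < m) - (a ^+ 2 * p ^+ i)^-1 = \prod_(i < m) - (a * p ^+ i)^-1 / a ^+ m).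
  have xa := poch_neq0 (fun i (_ : (i < m)%N) => a_nz i).
  have xp := poch_neq0 (fun i (_ : (i < m)%N) => p_nz i).
  have R0 : \prod_(i < m) - (a * p ^+ i)^-1 != 0.
    by apply/prodf_neq0 => i _; rewrite oppr_eq0 invr_eq0 mulf_neq0 ?expf_neq0.
  have am0 : a ^+ m != 0 by rewrite expf_neq0.
  move: (poch _ _ _) (poch _ _ _) (poch _ _ _) (\prod_(i < m) _) (a ^+ m) (p ^+ m) xa xp R0 am0.
  move=> x1 x2 x3 R am P h1 h2 h3 h4.
  by field; rewrite ?h1 ?h2 ?h3 ?h4.
have -> : a ^- m = \prod_(i < m) a^-1 by rewrite prodr_const card_ord exprVn.
rewrite -big_split.
apply: eq_bigr => i _ /=; have P0 := expf_neq0 i p0.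
by field; rewrite a0 P0.
Qed.
End Poch.

(** * Reflection of the summands *)

Section Reflection.
Variables (F : fieldType) (a p : F).
Hypothesis p0 : p != 0.

(** Squared so that the exponent [k l + k (k + 1) / 2] involves no halving. *)
Lemma sqr_prod_exp l k :
  (\prod_(i < k) p ^+ (l.+1 + i)) ^+ 2 = p ^+ (2 * k * l + k * k + k) :> F.
Proof.
elim: k => [|k IH]; first by rewrite big_ord0 expr1n muln0 mul0n.
rewrite big_ord_recr /= exprMn IH -exprM -exprD; congr (_ ^+ _); lia.
Qed.

(** Here [a = p / (p^(l+1) p^k)], so [poch_rev] with [y = p^(l+1)] turns [poch a p k] into the last
    [k] factors of [poch p p (k + l)], up to a monomial. *)
Lemma poch_reflect k l : a * p ^+ (k + l) = 1 ->
  poch a p k * poch p p l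
  = poch p p (k + l) * \prod_(i < k) - (p ^+ (l.+1 + i))^-1.
Proof.
move=> e; have -> : a = p / (p ^+ l.+1 * p ^+ k).
  apply: (mulIf (expf_neq0 (k + l) p0)); rewrite e -exprD addSn exprS (addnC l).
  by have h := expf_neq0 (k + l) p0; field; rewrite h p0.
rewrite poch_rev ?expf_neq0 // addnC pochD -exprS mulrAC [X in X * _]mulrC.
by congr (_ * _); apply: eq_bigr => i _; rewrite -exprD.
Qed.

(** The form makes the antisymmetry visible: exchanging [k] and [l] changes only the sign of the
    last factor. *)
Lemma wterm_reflect k l : a * p ^+ (k + l) = 1 ->
  (forall i, (i < k + l)%N -> 1 - p * p ^+ i != 0) ->
  wterm a p k
  = (poch p p (k + l) / (poch p p k * poch p p l)) ^+ 4 / p ^+ (2 * k * l)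
    * (p ^- k - p ^- l).
Proof.
move=> e nz.
have nzk : poch p p k != 0 by apply: poch_neq0 => i h; apply: nz; lia.
have nzl : poch p p l != 0 by apply: poch_neq0 => i h; apply: nz; lia.
have P0 j := expf_neq0 j p0.
have ea : a = (p ^+ k * p ^+ l)^-1.
  by apply: (mulIf (P0 (k + l)%N)); rewrite e exprD mulVf ?mulf_neq0.
(* The even power removes the signs of the reflection, and the fourth power of the monomial is the
   square of the one in [sqr_prod_exp]. *)
have e4 : poch a p k ^+ 4 * poch p p l ^+ 4
    = poch p p (k + l) ^+ 4 / p ^+ (2 * k * l + k * k + k) ^+ 2.
  rewrite -exprMn poch_reflect // exprMn -sqr_prod_exp; congr (_ * _).
  rewrite -exprM -exprVn -prodfV -!prodrXl; apply: eq_bigr => i _.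
  by rewrite -mulN1r exprMn -signr_odd mul1r.
rewrite /wterm !expr_div_n.
have -> : poch a p k ^+ 4 = poch p p (k + l) ^+ 4 / p ^+ (2 * k * l + k * k + k) ^+ 2
     / poch p p l ^+ 4 by rewrite -e4 mulfK ?expf_neq0.
have -> : p ^+ k / a ^+ 2 ^+ k = p ^+ (k + 2 * k * (k + l)).
  rewrite ea -exprD !exprVn invrK -!exprM -exprD; congr (_ ^+ _); lia.
have -> : p ^+ (2 * k * l + k * k + k) ^+ 2
          = p ^+ (2 * k * l) * p ^+ (k + 2 * k * (k + l)) * p ^+ k.
  by rewrite -exprM -!exprD; congr (_ ^+ _); lia.
rewrite ea; move: (P0 k) (P0 l) (P0 (2 * k * l)%N) (P0 (k + 2 * k * (k + l))%N).
move: (p ^+ _) (p ^+ _) (p ^+ _) (p ^+ _) nzk nzl => x y u v h1 h2 h3 h4 h5 h6.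
by field; rewrite h1 h2 h3 h4 h5 h6.
Qed.

Lemma weightV (y : F) : y != 0 -> y != 1 -> weight y^-1 = weight y.
Proof.
move=> y0 y1; rewrite /weight.
have h : 1 - y != 0 by rewrite subr_eq0 eq_sym.
have -> : 1 - y^-1 = - (1 - y) / y by field.
move: (1 - y) h => w h.
by field; rewrite oppr_eq0 y0 h.
Qed.

(** Minus the logarithmic derivative at [x = 0] of the deformation factor
    of the [k]-th summand. *)
Definition wdiff k : F :=
  \sum_(i < k) weight (a * p ^+ i) - \sum_(i < k) weight (p * p ^+ i).

(** Since [a p^i] is inverse to [p p^(k+l-1-i)] and [weight] is invariant under inversion, the
    weights of [a] are the last [k] weights of [p]. The result is symmetric in [k] and [l]. *)
Lemma wdiff_reflect k l : a * p ^+ (k + l) = 1 ->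
  (forall i, (i < k + l)%N -> 1 - p * p ^+ i != 0) ->
  wdiff k = \sum_(i < k + l) weight (p * p ^+ i)
            - \sum_(i < k) weight (p * p ^+ i) - \sum_(i < l) weight (p * p ^+ i).
Proof.
move=> e nz; rewrite /wdiff addnC big_split_ord /= [RHS]addrAC.
congr (_ - _); rewrite [RHS]addrC addKr (reindex_inj rev_ord_inj); apply: eq_bigr => -[i ik] _ /=.
rewrite -(@weightV (p * p ^+ (l + i))) ?mulf_neq0 ?expf_neq0 //; last first.
  by rewrite eq_sym -subr_eq0; apply: nz; lia.
congr weight; have P0 j := expf_neq0 j p0.
apply: (mulIf (mulf_neq0 p0 (P0 (l + i)%N))); rewrite mulVf ?mulf_neq0 //.
by rewrite -mulrA -exprS -exprD -e; congr (_ * _ ^+ _); lia.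
Qed.

End Reflection.

Lemma sum_antisym (R : numDomainType) (f : nat -> R) M :
  (forall k, (k <= M)%N -> f (M - k)%N = - f k) -> \sum_(k < M.+1) f k = 0.
Proof.
move=> h; apply/eqP; set S := \sum_(k < _) _.
suff: S *+ 2 == 0 by rewrite mulrn_eq0.
rewrite mulr2n /S {1}(reindex_inj rev_ord_inj) -big_split big1 // => -[k kM] _ /=.
by rewrite subSS h // addNr.
Qed.

(** * Values at roots of unity and cyclotomic divisibility *)

Local Notation pQtoC := (map_poly (ratr : rat -> algC)).

Lemma pQtoC_Phi e (z : algC) : e.-primitive_root z -> pQtoC (Phi e) = cyclotomic z e.
Proof.
move=> hz; rewrite -(Cintr_Cyclotomic hz) /Phi -map_poly_comp.
by apply: eq_map_poly => i /=; rewrite ratr_int.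
Qed.

Lemma Phi_dvd e (z : algC) (D : {poly rat}) :
  e.-primitive_root z -> (Phi e %| D) = root (pQtoC D) z.
Proof.
move=> hz; have [P [hP _ ->]] := minCpolyP z.
congr (_ %| _); apply: (map_inj_poly (fmorph_inj (ratr : {rmorphism rat -> algC})) (rmorph0 _)).
by rewrite /= -hP (minCpoly_cyclotomic hz) (pQtoC_Phi hz).
Qed.

Lemma coprimep_Phi e (z : algC) (D : {poly rat}) :
  e.-primitive_root z -> coprimep D (Phi e) = ~~ root (pQtoC D) z.
Proof.
move=> hz; rewrite -(coprimep_map (ratr : {rmorphism rat -> algC})) coprimep_sym /=.
rewrite (pQtoC_Phi hz); apply/Pdiv.ClosedField.coprimepP/idP => [h|h y].
  by apply/negP=> /eqP r0; have := h z; rewrite root_cyclotomic // hz r0 eqxx => /(_ isT).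
rewrite root_cyclotomic // => hy.
by move: h; rewrite -(Phi_dvd _ hz) (Phi_dvd _ hy).
Qed.

Lemma coprimep_Phi2 e e' : (0 < e)%N -> (0 < e')%N -> e != e' -> coprimep (Phi e) (Phi e').
Proof.
move=> e0 e'0 ne; have [z' hz'] := C_prim_root_exists e'0.
have [z hz] := C_prim_root_exists e0.
rewrite (coprimep_Phi _ hz') (pQtoC_Phi hz) root_cyclotomic //.
apply: contra ne => h; rewrite eqn_dvd (prim_order_dvd h) (prim_expr_order hz') eqxx.
by rewrite (prim_order_dvd hz') (prim_expr_order h) eqxx.
Qed.

Lemma prod_Phi n : (0 < n)%N -> \prod_(e <- divisors n) Phi e = 'X^n - 1.
Proof.
move=> n0; have := congr1 (map_poly (intr : int -> rat)) (prod_Cyclotomic n0).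
by rewrite rmorph_prod rmorphB rmorph1 /= map_polyXn.
Qed.

Lemma Phi1 : Phi 1 = 'X - 1.
Proof. by have := @prod_Phi 1 isT; rewrite big_seq1 expr1. Qed.

Lemma qint_polyE n : (0 < n)%N ->
  qint_poly n = \prod_(e <- divisors n | (e != 1)%N) Phi e.
Proof.
move=> n0; have X1 : 'X - 1 != 0 :> {poly rat} by rewrite polyXsubC_eq0.
apply: (mulfI X1); rewrite /qint_poly -subrX1 -(prod_Phi n0).
rewrite (bigD1_seq 1%N) ?divisors_uniq -?dvdn_divisors ?dvd1n //=.
by rewrite Phi1.
Qed.

Lemma prod_dvdp (I : eqType) (s : seq I) (P : I -> {poly rat}) (N : {poly rat}) :
  uniq s -> {in s &, forall i j, i != j -> coprimep (P i) (P j)} ->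
  {in s, forall i, P i %| N} -> \prod_(i <- s) P i %| N.
Proof.
elim: s => [|i s IH] /= => [_ _ _|/andP[nis us] co dv]; first by rewrite big_nil dvd1p.
rewrite big_cons Gauss_dvdp.
  rewrite dv ?mem_head // IH // => [j k js ks|j js]; last by rewrite dv // inE js orbT.
  by apply: co; rewrite inE ?js ?ks orbT.
rewrite big_seq; elim/big_ind: _ => [|x y hx hy|j js].
- exact: coprimep1.
- by rewrite coprimepMr hx hy.
- by apply: co; rewrite ?inE ?eqxx ?js ?orbT //; apply: contraNneq nis => ->.
Qed.

Lemma pfrac0 : pfrac 0 = 0. Proof. exact: rmorph0. Qed.
Lemma pfrac1 : pfrac 1 = 1. Proof. exact: rmorph1. Qed.
Lemma pfracD : {morph pfrac : x y / x + y}. Proof. exact: rmorphD. Qed.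
Lemma pfracN : {morph pfrac : x / - x}. Proof. exact: rmorphN. Qed.
Lemma pfracM : {morph pfrac : x y / x * y}. Proof. exact: rmorphM. Qed.
Lemma pfracX k : {morph pfrac : x / x ^+ k}. Proof. exact: rmorphXn. Qed.

(** [f] is regular at [z] and takes the value [v] there. For a primitive
    [e]-th root of unity [z] this is membership in the local ring at [Phi e],
    because [Phi e] is the minimal polynomial of [z]. *)
Definition has_value (z : algC) (f : RF) (v : algC) :=
  exists N D : {poly rat}, [/\ (pQtoC D).[z] != 0, f = pfrac N / pfrac D
                              & v = (pQtoC N).[z] / (pQtoC D).[z]].

Section HasValue.
Variable z : algC.
Local Notation hv := (has_value z).
Local Notation ev D := ((pQtoC D).[z]).

Lemma ev_neq0 D : ev D != 0 -> pfrac D != 0.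
Proof. by rewrite tofrac_eq0; apply: contra_neq => ->; rewrite rmorph0 horner0. Qed.

Lemma evM C D : ev (C * D) = ev C * ev D.
Proof. by rewrite rmorphM hornerM. Qed.

Lemma hv_poly N : hv (pfrac N) (ev N).
Proof.
exists N, 1; rewrite rmorph1 hornerC pfrac1 !divr1; split=> //; exact: oner_neq0.
Qed.

Lemma hvD f g u v : hv f u -> hv g v -> hv (f + g) (u + v).
Proof.
move=> [N [D [hD -> ->]]] [N' [D' [hD' -> ->]]]; exists (N * D' + N' * D), (D * D').
have nD := ev_neq0 hD; have nD' := ev_neq0 hD'.
split.
- by rewrite evM mulf_neq0.
- rewrite pfracD 3!pfracM; exact: addf_div nD nD'.
- rewrite rmorphD hornerD 3!evM; exact: addf_div hD hD'.
Qed.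

Lemma hvM f g u v : hv f u -> hv g v -> hv (f * g) (u * v).
Proof.
move=> [N [D [hD -> ->]]] [N' [D' [hD' -> ->]]]; exists (N * N'), (D * D').
split.
- by rewrite evM mulf_neq0.
- by rewrite 2!pfracM mulf_div.
- by rewrite 2!evM mulf_div.
Qed.

Lemma hvN f u : hv f u -> hv (- f) (- u).
Proof.
move=> [N [D [hD -> ->]]]; exists (- N), D.
by rewrite pfracN rmorphN hornerN !mulNr.
Qed.

Lemma hvB f g u v : hv f u -> hv g v -> hv (f - g) (u - v).
Proof. by move=> hf /hvN; apply: hvD. Qed.

Lemma hvV f u : u != 0 -> hv f u -> hv f^-1 u^-1.
Proof.
move=> u0 [N [D [hD -> e]]]; exists D, N; rewrite !invf_div e invf_div; split=> //.
by move: u0; rewrite e mulf_eq0 negb_or => /andP[].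
Qed.

Lemma hv_div f g u v : v != 0 -> hv f u -> hv g v -> hv (f / g) (u / v).
Proof. by move=> v0 hf /(hvV v0); apply: hvM. Qed.

Lemma hv0 : hv 0 0.
Proof. by have := hv_poly 0; rewrite pfrac0 rmorph0 horner0. Qed.

Lemma hv1 : hv 1 1.
Proof. by have := hv_poly 1; rewrite pfrac1 rmorph1 hornerC. Qed.

Lemma hv_sum (I : finType) (P : pred I) (f : I -> RF) u :
  (forall i, hv (f i) (u i)) -> hv (\sum_(i | P i) f i) (\sum_(i | P i) u i).
Proof. by move=> h; elim/big_ind2: _ => // [|????]; [apply: hv0 | apply: hvD]. Qed.

Lemma hv_prod (I : finType) (P : pred I) (f : I -> RF) u :
  (forall i, P i -> hv (f i) (u i)) -> hv (\prod_(i | P i) f i) (\prod_(i | P i) u i).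
Proof. by move=> h; elim/big_ind2: _ => // [|????]; [apply: hv1 | apply: hvM]. Qed.

Lemma hvX f u k : hv f u -> hv (f ^+ k) (u ^+ k).
Proof. by move=> h; rewrite -[k]card_ord -!prodr_const; apply: hv_prod => i _. Qed.

Lemma hv_q : hv qF z.
Proof. by have := hv_poly 'X; rewrite map_polyX hornerX. Qed.

Lemma hv_qpow k : z != 0 -> hv (qpow k) (z ^ k).
Proof.
rewrite /qpow => z0; case: k => k; first exact: hvX hv_q.
by rewrite NegzE -!exprz_inv; apply: hvX; apply: hvV hv_q.
Qed.

Lemma hv_poch a p u v k : hv a u -> hv p v -> hv (poch a p k) (poch u v k).
Proof.
move=> ha hp; apply: hv_prod => i _; apply: hvB hv1 _.
by apply: hvM ha _; apply: hvX.
Qed.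

Lemma hv_weight y u : 1 - u != 0 -> hv y u -> hv (weight y) (weight u).
Proof.
move=> u1 hy; apply: hv_div => //; first by rewrite expf_neq0.
by apply/hvX/hvB => //; apply: hv1.
Qed.

Lemma hv_neq0 f v : hv f v -> v != 0 -> f != 0.
Proof.
move=> [N [D [hD -> ->]]]; apply: contraNneq => /eqP.
rewrite mulf_eq0 invr_eq0 (negPf (ev_neq0 hD)) orbF tofrac_eq0 => /eqP ->.
by rewrite rmorph0 horner0 mul0r.
Qed.

End HasValue.

(** Divisibility by [Phi e ^+ r] in the local ring at [Phi e]. *)
Definition vanishes e (z : algC) r (f : RF) :=
  exists g v, has_value z g v /\ f = pfrac (Phi e) ^+ r * g.

Section Vanishes.
Variables (e : nat) (z : algC).
Hypothesis hz : e.-primitive_root z.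

Lemma vanishes1 f : has_value z f 0 -> vanishes e z 1 f.
Proof.
move=> [N [D [hD -> /esym/eqP]]]; rewrite mulf_eq0 invr_eq0 (negPf hD) orbF.
move=> /eqP/rootP; rewrite -(Phi_dvd _ hz) => /dvdpP[q ->].
exists (pfrac q / pfrac D), ((pQtoC q).[z] / (pQtoC D).[z]).
by split; [exists q, D | rewrite pfracM expr1; ring].
Qed.

Lemma vanishesM r s f g : vanishes e z r f -> vanishes e z s g -> vanishes e z (r + s) (f * g).
Proof.
move=> [f' [u [hf ->]]] [g' [v [hg ->]]]; exists (f' * g'), (u * v).
by split; [apply: hvM | rewrite exprD mulrACA].
Qed.

Lemma vanishesMr r f g v : has_value z g v -> vanishes e z r f -> vanishes e z r (f * g).
Proof.
move=> hg [f' [u [hf ->]]]; exists (f' * g), (u * v).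
by split; [apply: hvM | rewrite mulrA].
Qed.

Lemma vanishesD r f g : vanishes e z r f -> vanishes e z r g -> vanishes e z r (f + g).
Proof.
move=> [f' [u [hf ->]]] [g' [v [hg ->]]]; exists (f' + g'), (u + v).
by split; [apply: hvD | rewrite mulrDr].
Qed.

Lemma vanishesN r f : vanishes e z r f -> vanishes e z r (- f).
Proof.
move=> [f' [u [hf ->]]]; exists (- f'), (- u).
by split; [apply: hvN | rewrite mulrN].
Qed.

Lemma vanishesW r s f : (s <= r)%N -> vanishes e z r f -> vanishes e z s f.
Proof.
move=> /subnKC <- [f' [u [hf ->]]].
exists (pfrac (Phi e) ^+ (r - s) * f'), ((pQtoC (Phi e)).[z] ^+ (r - s) * u).
by split; [apply: hvM hf; apply/hvX/hv_poly | rewrite exprD mulrA].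
Qed.

Lemma vanishes_sum r (I : finType) (P : pred I) (f : I -> RF) :
  (forall i, P i -> vanishes e z r (f i)) -> vanishes e z r (\sum_(i | P i) f i).
Proof.
move=> h; elim/big_ind: _ => //; last exact: vanishesD.
by exists 0, 0; split; [apply: hv0 | rewrite mulr0].
Qed.

Lemma vanishesX r f k : vanishes e z r f -> vanishes e z (r * k) (f ^+ k).
Proof.
move=> hf; elim: k => [|k IH]; last by rewrite exprS mulnS; apply: vanishesM.
by rewrite muln0; exists 1, 1; split; [apply: hv1 | rewrite !expr0 mulr1].
Qed.

End Vanishes.

(** The modulus is a product of pairwise coprime powers of [Phi e] over the divisors [e > 1] of [n],
    with exponent 3 at [e = n]. A single reduced fraction for [A - B] serves all of them. *)
Lemma qcong_of_vanishes n (A B : RF) : (1 < n)%N ->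
  (forall e (z : algC), e.-primitive_root z -> (1 < e)%N -> (e %| n)%N ->
     vanishes e z (if e == n then 3 else 1) (A - B)) ->
  qcong A B (qint_poly n * Phi n ^+ 2).
Proof.
move=> n1 van; have n0 := ltnW n1.
have [N [D [D0 coND eAB]]] : exists N D : {poly rat},
    [/\ D != 0, coprimep N D & A - B = pfrac N / pfrac D].
  (* The local representation at [e = n] provides a fraction, and division by the gcd reduces it. *)
  have [z hz] := C_prim_root_exists n0.
  have [g [v [[N [D [hD -> _]] ->]]]] := van n z hz n1 (dvdnn n).
  set N' := Phi n ^+ (if n == n then 3 else 1) * N.
  have fD := ev_neq0 hD; have D0 : D != 0 by move: fD; rewrite tofrac_eq0.
  have G0 : gcdp N' D != 0 by rewrite gcdp_eq0 negb_and D0 orbT.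
  exists (N' %/ gcdp N' D), (D %/ gcdp N' D).
  have eN := divpK (dvdp_gcdl N' D); have eD := divpK (dvdp_gcdr N' D).
  have D'0 : D %/ gcdp N' D != 0 by apply: contra_neq D0 => q0; rewrite -eD q0 mul0r.
  split=> //; first by rewrite coprimep_div_gcd // D0 orbT.
  rewrite mulrA -pfracX -pfracM -/N' -[X in pfrac X / _ = _]eN -[X in _ / pfrac X = _]eD !pfracM.
  by rewrite -mulf_div divff ?tofrac_eq0 // mulr1.
have red e (z : algC) r : e.-primitive_root z -> vanishes e z r (A - B) ->
    Phi e ^+ r %| N /\ coprimep D (Phi e).
  move=> hz [g [v [[N' [D' [hD' -> _]] eAB']]]].
  have fD' := ev_neq0 hD'; have fD : pfrac D != 0 by rewrite tofrac_eq0.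
  have cross : N * D' = Phi e ^+ r * N' * D.
    move: eAB'; rewrite eAB mulrA -pfracX -pfracM => /eqP.
    rewrite (eqr_div _ _ fD fD') -2!pfracM => /eqP eND.
    by apply/eqP; rewrite -tofrac_eq; apply/eqP.
  have coD' : coprimep D' (Phi e) by rewrite (coprimep_Phi _ hz).
  split.
    rewrite -(@Gauss_dvdpl _ _ D') ?cross -?mulrA ?dvdp_mulIl //.
    by rewrite coprimep_sym coprimep_expr.
  (* By [cross], [D] divides [N * D']; being coprime to [N], it divides [D'], which is coprime to
     [Phi e]. *)
  apply: (coprimep_dvdr _ coD'); rewrite -(@Gauss_dvdpr _ _ N) 1?coprimep_sym //.
  by rewrite cross dvdp_mulIr.
have red1 e : e \in divisors n -> e != 1%N ->
    Phi e ^+ (if e == n then 3 else 1) %| N /\ coprimep D (Phi e).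
  rewrite -dvdn_divisors // => edv e1; have e0 := dvdn_gt0 n0 edv.
  have [z hz] := C_prim_root_exists e0.
  by apply: red hz (van _ _ hz _ edv); lia.
have mE : qint_poly n * Phi n ^+ 2
    = \prod_(e <- [seq e <- divisors n | e != 1%N]) Phi e ^+ (if e == n then 3 else 1).
  have nin : n \in [seq e <- divisors n | e != 1%N].
    by rewrite mem_filter -dvdn_divisors // dvdnn andbT; lia.
  rewrite qint_polyE // -big_filter !(bigD1_seq n nin) ?filter_uniq ?divisors_uniq //=.
  rewrite eqxx mulrAC -exprS; congr (_ * _).
  by apply: eq_bigr => e /negPf ->.
exists N, D; split=> //.
  rewrite mE big_seq; elim/big_ind: _ => [|x y hx hy|e].
  - exact: coprimep1.
  - by rewrite coprimepMr hx hy.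
  - by rewrite mem_filter => /andP[e1 edv]; apply: coprimep_expr; case: (red1 e edv e1).
rewrite mE; apply: prod_dvdp.
- by rewrite filter_uniq ?divisors_uniq.
- move=> e e'; rewrite !mem_filter -!dvdn_divisors // => /andP[_ h] /andP[_ h'] ne.
  by apply/coprimep_expl/coprimep_expr/coprimep_Phi2; rewrite ?(dvdn_gt0 n0).
- by move=> e; rewrite mem_filter => /andP[e1 edv]; case: (red1 e edv e1).
Qed.

(** * Block decomposition *)

Lemma qF_neq0 : qF != 0.
Proof. by rewrite tofrac_eq0 polyX_eq0. Qed.

Lemma qpow_neq0 k : qpow k != 0.
Proof. exact: expfz_neq0 qF_neq0. Qed.

Lemma qpowD k l : qpow (k + l) = qpow k * qpow l.
Proof. exact: expfzDr qF_neq0. Qed.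

Lemma qpowM k (i : nat) : qpow (k * i%:Z) = qpow k ^+ i.
Proof. by rewrite /qpow -exprz_exp. Qed.

Lemma qpowN k : qpow (- k) = (qpow k)^-1.
Proof. by rewrite /qpow invr_expz. Qed.

Lemma qpow_eq1 k : k != 0 -> 1 - qpow k != 0.
Proof.
have pos (i : nat) : (0 < i)%N -> 1 - qpow i != 0.
  move=> i0; rewrite subr_eq0 eq_sym /qpow -exprnP -pfracX -pfrac1 tofrac_eq.
  by rewrite -subr_eq0 -size_poly_eq0 size_XnsubC.
case: k => i i0; first by apply: pos; rewrite lt0n.
rewrite NegzE qpowN subr_eq0 eq_sym invr_eq1 eq_sym -subr_eq0; exact: pos.
Qed.

Section Local.
Variables (e : nat) (z : algC).
Hypothesis hz : e.-primitive_root z.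

Let z0 : z != 0.
Proof. by rewrite (prim_root_eq0 hz) -lt0n (prim_order_gt0 hz). Qed.

Lemma zpow_order k : z ^ (e%:Z * k) = 1.
Proof. by rewrite -exprz_exp -exprnP (prim_expr_order hz) exp1rz. Qed.

(** After cancelling [1 - q^e], geometric sums remain whose values at [z] are their lengths, the
    lower one [l + 1] being nonzero. A negative [k] is made positive by extracting a power of
    [q]. *)
Lemma hv_qratio (k : int) (l : nat) : exists v,
  has_value z ((1 - qpow (e%:Z * k)) / (1 - qpow (e%:Z * l.+1%:Z))) v.
Proof.
have geom (i : nat) : 1 - qpow (e%:Z * i%:Z) = (1 - qpow e) * \sum_(j < i) qpow e ^+ j.
  by rewrite qpowM -(opprB _ 1) subrX1 -mulNr opprB.
have hgeom i : has_value z (\sum_(j < i) qpow e ^+ j) i%:R.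
  have -> : i%:R = \sum_(j < i) (1 : algC) ^+ j.
    by under eq_bigr do rewrite expr1n; rewrite sumr_const card_ord.
  apply: hv_sum => j; apply: hvX.
  by have := hv_qpow e z0; rewrite -exprnP prim_expr_order.
have e0 : 1 - qpow e != 0 by apply: qpow_eq1; have := prim_order_gt0 hz; case: (e).
have l0 : l.+1%:R != 0 :> algC by rewrite pnatr_eq0.
have main (i : nat) : exists v,
    has_value z ((1 - qpow (e%:Z * i%:Z)) / (1 - qpow (e%:Z * l.+1%:Z))) v.
  exists (i%:R / l.+1%:R); rewrite !geom -mulf_div divff // mul1r.
  exact: hv_div l0 (hgeom i) (hgeom l.+1).
case: k => i; first exact: main.
have [v hv] := main i.+1; exists (- z ^ (e%:Z * - i.+1%:Z) * v).
have -> : (1 - qpow (e%:Z * Negz i)) = - qpow (e%:Z * - i.+1%:Z) * (1 - qpow (e%:Z * i.+1%:Z)).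
  rewrite NegzE mulrBr mulr1 mulNr -qpowD mulrN addNr /qpow expr0z opprK addrC; ring.
rewrite -mulrA; apply: hvM hv; apply: hvN; exact: hv_qpow z0.
Qed.

Section Blocks.
Variables (d : nat) (s S : int) (M : nat).
Hypotheses (d0 : (0 < d)%N) (co_ed : coprime e d) (Me : (M < e)%N).
(** Makes [M] the index below [e] at which [1 - a p^i] vanishes at [z]. The exponent [s] is general
    because both [q^t] and [q^(2t)] will occur as [a]. *)
Hypothesis hS : s + d%:Z * M%:Z = e%:Z * S.

Local Notation a := (qpow s).
Local Notation p := (qpow d%:Z).
Local Notation alpha := (z ^ s).
Local Notation pi := (z ^ d%:Z).

Lemma pi_exp i : pi ^+ i = z ^+ (d * i).
Proof. by rewrite -exprnP exprM. Qed.

Lemma pi_block l : pi ^+ (l * e) = 1.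
Proof. by rewrite pi_exp mulnA [(_ * e)%N]mulnC exprM (prim_expr_order hz) expr1n. Qed.

Lemma pi_neq1 i : (0 < i < e)%N -> 1 - pi ^+ i != 0.
Proof.
move=> /andP[i0 ie]; rewrite subr_eq0 eq_sym pi_exp -(prim_order_dvd hz).
by rewrite Gauss_dvdr // gtnNdvd.
Qed.

Lemma pi_nz i : (i.+1 < e)%N -> 1 - pi * pi ^+ i != 0.
Proof. by move=> ie; rewrite -exprS pi_neq1. Qed.

Lemma alpha_pi : alpha * pi ^+ M = 1.
Proof. by rewrite exprnP exprz_exp -expfzDr // hS zpow_order. Qed.

Lemma hv_a : has_value z a alpha. Proof. exact: hv_qpow. Qed.
Lemma hv_p : has_value z p pi. Proof. exact: hv_qpow. Qed.

Lemma hv_p_block l : has_value z (p ^+ (l * e)) 1.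
Proof. by rewrite -(pi_block l); apply/hvX/hv_p. Qed.

Lemma hv_ratio_step l j : (j < e)%N ->
  has_value z (poch (a * p ^+ (l * e)) p j / poch (p * p ^+ (l * e)) p j)
              (poch alpha pi j / poch pi pi j).
Proof.
move=> je; apply: hv_div.
- by apply: poch_neq0 => i ij; apply: pi_nz; apply: leq_ltn_trans je.
- by have := hv_poch j (hvM hv_a (hv_p_block l)) hv_p; rewrite mulr1.
- by have := hv_poch j (hvM hv_p (hv_p_block l)) hv_p; rewrite mulr1.
Qed.

Lemma ratio_split k l : poch a p (k + l) / poch p p (k + l)
  = poch a p k / poch p p k * (poch (a * p ^+ k) p l / poch (p * p ^+ k) p l).
Proof. by rewrite !pochD -mulf_div. Qed.

(** In each block of [e] consecutive factors, the single denominator that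
    vanishes at [z] is compensated by the numerator of index [M]. *)
Lemma hv_block l : exists U, has_value z (poch a p (l * e) / poch p p (l * e)) U.
Proof.
elim: l => [|l [U hU]].
  by exists 1; rewrite mul0n !poch0 divr1; apply: hv1.
rewrite mulSn addnC ratio_split.
suff [V hV] : exists V, has_value z
    (poch (a * p ^+ (l * e)) p e / poch (p * p ^+ (l * e)) p e) V.
  by exists (U * V); apply: hvM.
have e0 := prim_order_gt0 hz.
(* The last factor, [1 - q^(e d (l+1))], is the one in the denominator that vanishes at [z]. *)
have -> : poch (p * p ^+ (l * e)) p e
    = poch (p * p ^+ (l * e)) p e.-1 * (1 - qpow (e%:Z * (d * l.+1)%N%:Z)).
  have := pochSr (p * p ^+ (l * e)) p e.-1; rewrite (prednK e0) => ->.
  congr (_ * (1 - _)).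
  rewrite -exprS -exprD; have -> : ((l * e).+1 + e.-1 = l.+1 * e)%N by lia.
  by rewrite -qpowM -!PoszM mulnA [(_ * e)%N]mulnC.
have [l' el] : exists l', (d * l.+1)%N = l'.+1.
  by exists (d * l.+1).-1; rewrite prednK // muln_gt0 d0.
rewrite el.
have [w hw] := hv_qratio (S + (d * l)%N%:Z) l'.
have eM : 1 - a * p ^+ (l * e) * p ^+ M = 1 - qpow (e%:Z * (S + (d * l)%N%:Z)).
  rewrite -!qpowM -!qpowD; congr (1 - qpow _); rewrite mulrDr -hS !PoszM; ring.
pose Q := \prod_(i < e | i != Ordinal Me) (1 - a * p ^+ (l * e) * p ^+ i).
have [x hQ] : exists x, has_value z (Q / poch (p * p ^+ (l * e)) p e.-1) x.
  exists (\prod_(i < e | i != Ordinal Me) (1 - alpha * 1 * pi ^+ i) / poch (pi * 1) pi e.-1).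
  apply: hv_div.
  - by rewrite mulr1; apply: poch_neq0 => i ij; apply: pi_nz; lia.
  - apply: hv_prod => i _; apply: hvB; first exact: hv1.
    exact: hvM (hvM hv_a (hv_p_block l)) (hvX _ hv_p).
  - exact: hv_poch (hvM hv_p (hv_p_block l)) hv_p.
exists (w * x); rewrite {1}/poch (bigD1 (Ordinal Me)) //= -/Q eM.
rewrite [X in _ / X]mulrC -mulf_div; exact: hvM hw hQ.
Qed.

(** The constant [U], the value at the start of the block, is fixed before [j]; the other [j]
    factors behave as in the first block because [p^(l e)] takes the value 1. *)
Lemma hv_ratio l : exists U, forall j, (j < e)%N ->
  has_value z (poch a p (l * e + j) / poch p p (l * e + j))
              (U * (poch alpha pi j / poch pi pi j)).
Proof.
have [U hU] := hv_block l; exists U => j je; rewrite ratio_split.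
exact: hvM hU (hv_ratio_step l je).
Qed.

Lemma alpha_order : alpha ^+ e = 1.
Proof. by rewrite exprnP exprz_exp mulrC zpow_order. Qed.

Lemma alpha_neq0 : alpha != 0. Proof. exact: expfz_neq0. Qed.
Lemma pi_neq0 : pi != 0. Proof. exact: expfz_neq0. Qed.

Lemma hv_wterm l : exists U, forall j, (j < e)%N ->
  has_value z (wterm a p (l * e + j)) (U * wterm alpha pi j).
Proof.
have [U hU] := hv_ratio l; exists (U ^+ 4) => j je.
have -> : U ^+ 4 * wterm alpha pi j
    = (1 - alpha * pi ^+ (l * e + j) ^+ 2) * (U * (poch alpha pi j / poch pi pi j)) ^+ 4
      * (pi / alpha ^+ 2) ^+ (l * e + j).
  have e1 : (pi / alpha ^+ 2) ^+ (l * e) = 1.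
    rewrite expr_div_n pi_block -exprM (_ : (2 * (l * e) = e * (2 * l))%N); last by lia.
    by rewrite exprM alpha_order expr1n divr1.
  rewrite /wterm !exprD pi_block e1 !mul1r; ring.
apply: hvM.
  apply: hvM; last by apply: hvX; apply: hU.
  apply: hvB; first exact: hv1.
  by apply: hvM hv_a _; apply/hvX/hvX/hv_p.
apply: hvX; apply: hv_div hv_p _; first by rewrite expf_neq0 ?alpha_neq0.
exact: hvX hv_a.
Qed.

Lemma wterm_alpha_sym j : (j <= M)%N ->
  wterm alpha pi (M - j) = - wterm alpha pi j.
Proof.
move=> jM; have nz i : (i < M)%N -> 1 - pi * pi ^+ i != 0 by move=> iM; apply: pi_nz; lia.
have := @wterm_reflect _ alpha pi pi_neq0 (M - j) j.
have := @wterm_reflect _ alpha pi pi_neq0 j (M - j).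
rewrite subnK // subnKC // => -> //; last exact: alpha_pi.
move=> -> //; last exact: alpha_pi.
rewrite [poch _ _ j * _]mulrC -mulrN opprB mulnAC.
by congr (_ / _ ^+ _ * _); lia.
Qed.

Lemma wdiff_alpha_sym j : (j <= M)%N -> wdiff alpha pi (M - j) = wdiff alpha pi j.
Proof.
move=> jM; have nz i : (i < M)%N -> 1 - pi * pi ^+ i != 0 by move=> iM; apply: pi_nz; lia.
have := @wdiff_reflect _ alpha pi pi_neq0 (M - j) j.
have := @wdiff_reflect _ alpha pi pi_neq0 j (M - j).
rewrite subnK // subnKC // => -> //; last exact: alpha_pi.
move=> -> //; last exact: alpha_pi.
by rewrite addrAC.
Qed.

Lemma poch_alpha0 j : (M < j)%N -> poch alpha pi j = 0.
Proof. by move=> Mj; apply: poch_eq0 Mj alpha_pi. Qed.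

Lemma wterm_alpha0 j : (M < j)%N -> wterm alpha pi j = 0.
Proof. by move=> Mj; rewrite /wterm poch_alpha0 // mul0r expr0n mulr0 mul0r. Qed.

(** The terms up to [M] cancel by antisymmetry, and the later ones contain the factor
    [1 - alpha pi^M = 0]. *)
Lemma sum_wterm_alpha j : (M < j)%N -> \sum_(k < j) wterm alpha pi k = 0.
Proof.
move=> Mj; rewrite -(subnKC Mj) big_split_ord /= (sum_antisym wterm_alpha_sym) add0r.
by apply: big1 => k _; apply: wterm_alpha0; lia.
Qed.

Lemma hv_sum_chunk l j : (M < j <= e)%N -> has_value z (\sum_(k < j) wterm a p (l * e + k)) 0.
Proof.
move=> /andP[Mj je]; have [U hU] := hv_wterm l.
rewrite -(mulr0 U) -(sum_wterm_alpha Mj) mulr_sumr; apply: hv_sum => k.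
by apply: hU; apply: leq_trans je.
Qed.

(** Serves both sums of the theorem: [j = e] gives full blocks, while [j = M + 1] ends in an
    incomplete block that stops just after its index [M]. *)
Lemma hv_sum_wterm l j : (M < j <= e)%N ->
  has_value z (\sum_(k < l * e + j) wterm a p k) 0.
Proof.
move=> Mj; rewrite big_split_ord /= -(addr0 (0 : algC)); apply: hvD; last exact: hv_sum_chunk.
elim: l => [|l IH]; first by rewrite mul0n big_ord0; apply: hv0.
rewrite mulSn addnC big_split_ord /= -(addr0 (0 : algC)); apply: hvD => //.
by apply: hv_sum_chunk; lia.
Qed.

End Blocks.
End Local.

(** * The cube of the cyclotomic polynomial *)

Lemma one_sub_div_expand (F : fieldType) (x a b : F) : 1 - x * b != 0 ->
  (1 - x * a) / (1 - x * b)
  = 1 - x * (a - b) + x ^+ 2 * (- (b * (a - b)) / (1 - x * b)).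
Proof. by move=> h; field. Qed.

Lemma expand_mul (R : comPzRingType) (x F G a b r s : R) :
  (1 - x * (F - G) + x ^+ 2 * r) * (1 - x * (a - b) + x ^+ 2 * s)
  = 1 - x * (F + a - (G + b))
    + x ^+ 2 * ((F - G) * (a - b) + s - x * (F - G) * s
                + r * (1 - x * (a - b) + x ^+ 2 * s)).
Proof. ring. Qed.

(** First-order expansion in [x], one factor at a time; the remainder stays regular because each
    [1 - x * g i] takes the value 1 at [z]. *)
Lemma prod_ratio_expand z (x : RF) (f g : nat -> RF) k : has_value z x 0 ->
  (forall i, (i < k)%N -> exists v, has_value z (f i) v) ->
  (forall i, (i < k)%N -> exists v, has_value z (g i) v) ->
  exists r v, has_value z r v /\
    \prod_(i < k) (1 - x * f i) / \prod_(i < k) (1 - x * g i)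
    = 1 - x * (\sum_(i < k) f i - \sum_(i < k) g i) + x ^+ 2 * r.
Proof.
move=> hx; elim: k => [|k IH] hf hg.
  exists 0, 0; split; first exact: hv0.
  by rewrite !big_ord0 subrr !mulr0 subr0 addr0 divr1.
have [||r [v [hr er]]] := IH.
- by move=> i ik; apply: hf; apply: leqW.
- by move=> i ik; apply: hg; apply: leqW.
have sumv (h : nat -> RF) : (forall i, (i < k.+1)%N -> exists v, has_value z (h i) v) ->
    exists v, has_value z (\sum_(i < k) h i) v.
  move=> hh; elim/big_ind: _ => [|a b [u hu] [w hw]|[i ik] _]; first by exists 0; apply: hv0.
    by exists (u + w); apply: hvD.
  by apply: hh; apply: leqW.
have [D1 hD1] := sumv _ hf; have [D2 hD2] := sumv _ hg.
have [u hu] := hf k (ltnSn k); have [w hw] := hg k (ltnSn k).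
rewrite !big_ord_recr /= -mulf_div er.
move: (\sum_(i < k) f i) (\sum_(i < k) g i) hD1 hD2 => F G hF hG {er hf hg IH sumv}.
move: (f k) (g k) hu hw => a b ha hb.
have hb1 : has_value z (1 - x * b) 1.
  by have := hvB (hv1 z) (hvM hx hb); rewrite mul0r subr0.
have b1 : 1 - x * b != 0 by apply: hv_neq0 hb1 (oner_neq0 _).
pose s := - (b * (a - b)) / (1 - x * b).
have es : (1 - x * a) / (1 - x * b) = 1 - x * (a - b) + x ^+ 2 * s.
  exact: one_sub_div_expand.
have hs : has_value z s (- (w * (u - w)) / 1).
  apply: hv_div hb1; first exact: oner_neq0.
  exact/hvN/hvM/hvB.
have hF' := hvB hF hG; have hab := hvB ha hb.
exists ((F - G) * (a - b) + s - x * (F - G) * s + r * (1 - x * (a - b) + x ^+ 2 * s)).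
eexists; split; last by rewrite es; exact: expand_mul.
apply: hvD; last first.
  apply: hvM hr _; apply: hvD; last exact: hvM (hvX 2 hx) hs.
  exact: hvB (hv1 z) (hvM hx hab).
apply: hvB; last exact: hvM (hvM hx hF') hs.
exact: hvD (hvM hF' hab) hs.
Qed.

Lemma split_deformation (R : comPzRingType) (w r x y : R) :
  w - w * r = x * (w * y) + w * (1 - r - x * y).
Proof. ring. Qed.

Lemma remainder_deformation (R : comPzRingType) (x D r : R) :
  1 - (1 - x * D + x ^+ 2 * r) - x * D = - (x ^+ 2 * r).
Proof. ring. Qed.

Section Cube.
Variables (n : nat) (z : algC).
Hypothesis hz : n.-primitive_root z.
Variables (d : nat) (t : int) (m : nat).
Hypotheses (d0 : (0 < d)%N) (co_nd : coprime n d) (mn : (m < n)%N).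
Hypothesis hm : t + d%:Z * m%:Z = n%:Z.
(** This and the next hypothesis keep [1 - a p^i] and [1 - p^(i+1) / q^n] nonzero, as the 6phi5 sum
    requires. *)
Hypothesis t_nz : forall i : nat, t + d%:Z * i%:Z != 0.
Hypothesis n_nz : forall i : nat, d%:Z * i.+1%:Z - n%:Z != 0.

Local Notation a := (qpow t).
Local Notation p := (qpow d%:Z).
Local Notation alpha := (z ^ t).
Local Notation pi := (z ^ d%:Z).

Let z0 : z != 0.
Proof. by rewrite (prim_root_eq0 hz) -lt0n (prim_order_gt0 hz). Qed.

Let hS : t + d%:Z * m%:Z = n%:Z * 1. Proof. by rewrite mulr1. Qed.

Lemma hv_sub_qn : has_value z (1 - qpow n) 0.
Proof.
have := hvB (hv1 z) (hv_qpow n z0).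
by rewrite -exprnP (prim_expr_order hz) subrr.
Qed.

Lemma hv_weight_a i : (i < m)%N -> has_value z (weight (a * p ^+ i)) (weight (alpha * pi ^+ i)).
Proof.
move=> im; apply: hv_weight; last exact: hvM (hv_a hz t) (hvX _ (hv_p hz d)).
(* If [alpha pi^i] were 1, so would be [pi^(m-i)], although [0 < m - i < n]. *)
have := alpha_pi hz hS; rewrite -(subnKC (ltnW im)) exprD mulrA => e.
have : 1 - pi ^+ (m - i) != 0 by apply: (pi_neq1 hz co_nd); lia.
by apply: contraNneq => /subr0_eq e1; move: e; rewrite -e1 mul1r => ->; rewrite subrr.
Qed.

Lemma hv_weight_p i : (i < m)%N -> has_value z (weight (p * p ^+ i)) (weight (pi * pi ^+ i)).
Proof.
move=> im; apply: hv_weight; last exact: hvM (hv_p hz d) (hvX _ (hv_p hz d)).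
by apply: (pi_nz hz co_nd); lia.
Qed.

Lemma hv_wdiff k : (k <= m)%N -> has_value z (wdiff a p k) (wdiff alpha pi k).
Proof.
move=> km; apply: hvB; apply: hv_sum => i.
  by apply: hv_weight_a; apply: leq_trans km.
by apply: hv_weight_p; apply: leq_trans km.
Qed.

Lemma qpow_top : a * p ^+ m = qpow n.
Proof. by rewrite -qpowM -qpowD hm. Qed.

(** The right-hand side of the theorem multiplied by [1 - q]. *)
Definition closed_form : RF :=
  (1 - a * p ^+ m) * (poch (a ^+ 2) p m / poch p p m) / a ^+ m.

Lemma vanishes_truncated :
  vanishes n z 3 (\sum_(k < m.+1) wterm a p k - closed_form).
Proof.
pose x := (1 - a * p ^+ m) ^+ 2 / (a * p ^+ m).
pose rho k := \prod_(i < k) (1 - x * weight (a * p ^+ i))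
              / \prod_(i < k) (1 - x * weight (p * p ^+ i)).
have x2 : vanishes n z 2 x.
  rewrite /x qpow_top; apply: vanishesMr (vanishesX 2 (vanishes1 hz hv_sub_qn)).
  exact: hvV (expfz_neq0 n z0) (hv_qpow n z0).
have hx : has_value z x 0.
  have hn := hv_qpow n z0; have n0 := expfz_neq0 n z0.
  have := hvM (hvX 2 hv_sub_qn) (hvV n0 hn).
  by rewrite expr0n mul0r /x qpow_top.
have -> : closed_form = \sum_(k < m.+1) wterm a p k * rho k.
  symmetry; apply: sum_deformed_wterm.
  - exact: qpow_neq0.
  - exact: qpow_neq0.
  - by move=> i; rewrite -qpowM -qpowD; apply: qpow_eq1.
  - by move=> i; rewrite -exprS -qpowM; apply: qpow_eq1; lia.
  - move=> i; rewrite qpow_top mulrAC -exprS -qpowM -qpowN -qpowD; exact: qpow_eq1.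
have [U hU] := hv_wterm hz d0 co_nd mn hS 0.
have hw k : (k <= m)%N -> has_value z (wterm a p k) (U * wterm alpha pi k).
  by move=> km; apply: hU; apply: leq_ltn_trans mn.
(* Separates the term linear in [x] from the higher-order remainder. *)
have -> : \sum_(k < m.+1) wterm a p k - \sum_(k < m.+1) wterm a p k * rho k
    = x * (\sum_(k < m.+1) wterm a p k * wdiff a p k)
      + \sum_(k < m.+1) wterm a p k * (1 - rho k - x * wdiff a p k).
  rewrite -sumrB mulr_sumr -big_split; apply: eq_bigr => k _ /=.
  exact: split_deformation.
apply: vanishesD.
  (* The factor [x] gives order two; its coefficient gives the third, being at [z] a sum of
     antisymmetric times symmetric terms. *)
  apply: (vanishesM (r := 2) (s := 1)) => //; apply: (vanishes1 hz).
  have -> : 0 = \sum_(k < m.+1) U * wterm alpha pi k * wdiff alpha pi k :> algC.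
    symmetry; apply: (@sum_antisym _ (fun k => U * wterm alpha pi k * wdiff alpha pi k)) => k km.
    rewrite (wterm_alpha_sym hz d0 co_nd mn hS km) (wdiff_alpha_sym hz d0 co_nd mn hS km).
    by rewrite mulrN mulNr.
  by apply: hv_sum => -[k km]; exact: hvM (hw k km) (hv_wdiff km).
apply: vanishes_sum => -[k km] _ /=; rewrite mulrC; apply: vanishesMr (hw k km) _.
have [||r [v [hr er]]] := @prod_ratio_expand z x
  (fun i => weight (a * p ^+ i)) (fun i => weight (p * p ^+ i)) k hx.
- move=> i ik; eexists; apply: hv_weight_a; exact: leq_trans ik km.
- move=> i ik; eexists; apply: hv_weight_p; exact: leq_trans ik km.
rewrite /rho er remainder_deformation.
(* The remainder is [x^2] times a regular function, hence of order four. *)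
apply: vanishesW (isT : (3 <= 2 * 2)%N) _; apply: vanishesN.
by apply: vanishesMr hr _; apply: vanishesX.
Qed.

(** For these [k] the numerator contains [1 - a p^m = 1 - q^n] while the denominator is nonzero at
    [z], so the fourth power of the ratio vanishes to order four. *)
Lemma vanishes_tail k : (m < k < n)%N -> vanishes n z 3 (wterm a p k).
Proof.
move=> /andP[mk kn]; have [U hU] := hv_ratio hz d0 co_nd mn hS 0.
have := hU k kn; rewrite (poch_alpha0 hz hS mk) mul0r mulr0 => /(vanishes1 hz)/(vanishesX 4).
move=> /(vanishesW (isT : (3 <= 1 * 4)%N)) h4.
have ha := hv_a hz t; have hp := hv_p hz d.
rewrite /wterm mulrAC mulrC.
apply: vanishesMr h4; apply: hvM.
  apply: hvB; first exact: hv1.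
  exact: hvM ha (hvX 2 (hvX k hp)).
apply/hvX/(hv_div _ hp (hvX 2 ha)); rewrite expf_neq0 //; exact: expfz_neq0.
Qed.

End Cube.

(** * First-order vanishing at the divisors of [n] *)

Section Divisor.
Variables (e : nat) (z : algC).
Hypothesis hz : e.-primitive_root z.
Variables (n d : nat) (t : int) (m : nat).
Hypotheses (d0 : (0 < d)%N) (co_nd : coprime n d) (en : (e %| n)%N).
Hypothesis hm : t + d%:Z * m%:Z = n%:Z.

Let e0 : (0 < e)%N. Proof. exact: prim_order_gt0 hz. Qed.
Let co_ed : coprime e d. Proof. exact: coprime_dvdl en co_nd. Qed.
Let hn : n = (n %/ e * e)%N. Proof. by rewrite divnK. Qed.

Let modM : (m %% e < e)%N. Proof. exact: ltn_pmod. Qed.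

(** Reducing [m] modulo [e] brings [t + d m = n] to the form used for blocks. *)
Let hS : t + d%:Z * (m %% e)%N%:Z = e%:Z * ((n %/ e)%N%:Z - d%:Z * (m %/ e)%N%:Z).
Proof.
have := congr1 Posz hn; have := congr1 Posz (divn_eq m e).
rewrite PoszD !PoszM => em en'; rewrite mulrBr [e%:Z * (n %/ e)%N%:Z]mulrC -en' -hm [in RHS]em.
ring.
Qed.

(** The factor [1 - q^n] vanishes at [z]. The quotient of shifted factorials is regular by the block
    argument with [s = 2t] and [M = 2m mod e], since [2t + d (2m) = 2n]. *)
Lemma hv_closed_form : has_value z (closed_form d t m) 0.
Proof.
have z0 : z != 0 by rewrite (prim_root_eq0 hz) -lt0n.
have hS2 : 2 * t + d%:Z * ((2 * m) %% e)%N%:Z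
    = e%:Z * (2 * (n %/ e)%N%:Z - d%:Z * ((2 * m) %/ e)%N%:Z).
  have := congr1 Posz hn; have := congr1 Posz (divn_eq (2 * m) e).
  rewrite PoszD !PoszM => em en'; rewrite mulrBr.
  have -> : e%:Z * (2 * (n %/ e)%N%:Z) = 2 * n%:Z by rewrite [in RHS]en'; ring.
  have -> : 2 * n%:Z = 2 * t + d%:Z * (2 * m%:Z) by rewrite -hm; ring.
  rewrite em; ring.
have [U hU] := hv_ratio hz d0 co_ed (ltn_pmod _ e0) hS2 (m %/ e).
have := hU _ modM; rewrite -divn_eq => hV.
have hn0 : has_value z (1 - qpow n) 0.
  have := hvB (hv1 z) (hv_qpow n z0).
  by rewrite -(subrr 1) hn PoszM mulrC zpow_order.
have ha := hvX m (hv_a hz t).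
have := hvM (hvM hn0 hV) (hvV (expf_neq0 m (expfz_neq0 t z0)) ha).
rewrite !mul0r /closed_form (qpow_top hm).
by rewrite [2 * t]mulrC (qpowM t 2).
Qed.

Lemma hv_sub_truncated :
  has_value z (\sum_(k < m.+1) wterm (qpow t) (qpow d%:Z) k - closed_form d t m) 0.
Proof.
rewrite -(subr0 (0 : algC)); apply: hvB hv_closed_form.
have := hv_sum_wterm hz d0 co_ed modM hS (m %/ e) (j := (m %% e).+1).
rewrite addnS -divn_eq; apply; by rewrite ltnSn modM.
Qed.

Lemma hv_sub_full :
  has_value z (\sum_(k < n) wterm (qpow t) (qpow d%:Z) k - closed_form d t m) 0.
Proof.
rewrite -(subr0 (0 : algC)); apply: hvB hv_closed_form.
have [n0|n0] := posnP n; first by rewrite n0 big_ord0; apply: hv0.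
have nE : ((n %/ e).-1 * e + e = n)%N.
  have q0 : (0 < n %/ e)%N by rewrite divn_gt0 // (dvdn_leq n0 en).
  by rewrite addnC -mulSn (prednK q0) divnK.
have := hv_sum_wterm hz d0 co_ed modM hS (n %/ e).-1 (j := e).
by rewrite nE; apply; rewrite leqnn andbT.
Qed.

End Divisor.

(** * From the local statements to the two congruences *)

Lemma summandE d t k :
  qint (2 * d%:Z * k%:Z + t)
    * (qpoch (qpow t) (qpow d%:Z) k) ^+ 4 / (qpoch (qpow d%:Z) (qpow d%:Z) k) ^+ 4
    * qpow ((d%:Z - 2 * t) * k%:Z)
  = wterm (qpow t) (qpow d%:Z) k / (1 - qF).
Proof.
have e1 : qpow (2 * d%:Z * k%:Z + t) = qpow t * qpow d%:Z ^+ k ^+ 2.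
  have -> : 2 * d%:Z * k%:Z + t = t + d%:Z * (k * 2)%N%:Z by rewrite PoszM; ring.
  by rewrite qpowD qpowM exprM.
have e2 : qpow (d%:Z - 2 * t) = qpow d%:Z / qpow t ^+ 2.
  by rewrite qpowD qpowN [2 * t]mulrC (qpowM t 2).
rewrite qpowM e2 /qint e1 /wterm (expr_div_n (poch _ _ _)).
change (qpoch (qpow t) (qpow d%:Z) k) with (poch (qpow t) (qpow d%:Z) k).
change (qpoch (qpow d%:Z) (qpow d%:Z) k) with (poch (qpow d%:Z) (qpow d%:Z) k).
have arrange (F : fieldType) (A B X Y Z : F) :
  A / B * X / Y * Z = A * (X / Y) * Z / B by ring.
exact: arrange.
Qed.

Theorem theorem5 (n d : nat) (t : int) :
  (1 < n)%N -> (2 <= d)%N ->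
  coprimez t d ->
  (n%:Z = t %[mod d%:Z])%Z ->
  n%:Z + d%:Z - n%:Z * d%:Z <= t -> t <= n%:Z ->
  let m : nat := `|((n%:Z - t) %/ d%:Z)%Z|%N in
  let term (k : nat) : RF :=
    qint (2 * d%:Z * k%:Z + t)
    * (qpoch (qpow t) (qpow d%:Z) k) ^+ 4 / (qpoch (qpow d%:Z) (qpow d%:Z) k) ^+ 4
    * qpow ((d%:Z - 2 * t) * k%:Z) in
  let rhs : RF :=
    qpoch (qpow (2 * t)) (qpow d%:Z) m / qpoch (qpow d%:Z) (qpow d%:Z) m
    * qint n%:Z * qpow ((t * (t - n%:Z)) %/ d%:Z)%Z in
  let modulus : {poly rat} := qint_poly n * Phi n ^+ 2 in
  qcong (\sum_(k < m.+1) term k) rhs modulus /\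
  qcong (\sum_(k < n) term k) rhs modulus.
Proof.
move=> n1 d2 co_td tn lo hi m term rhs modulus.
have d0 : (0 < d)%N := ltnW d2.
have dZ : d%:Z != 0 by rewrite lt0r_neq0 // ltz_nat.
have hm : t + d%:Z * m%:Z = n%:Z.
  have dv : (d%:Z %| n%:Z - t)%Z by rewrite -eqz_mod_dvd; apply/eqP.
  have mE : m%:Z = ((n%:Z - t) %/ d%:Z)%Z by rewrite /m gez0_abs // divz_ge0 ?ltz_nat // subr_ge0.
  by rewrite mE mulrC divzK // addrC subrK.
(* The lower bound on [t] amounts to [d m <= d (n - 1)]. *)
have mn : (m < n)%N by nia.
(* A multiple of [d >= 2] is not coprime to [d]; this keeps the exponents in the denominators away
   from zero. *)
have not_dvd k : t != d%:Z * k.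
  apply: contraTneq co_td => ->.
  by rewrite coprimezE abszM coprimeMl absz_nat {1}/coprime gcdnn gtn_eqF.
have co_nd : coprime n d.
  have : coprimez n%:Z d%:Z.
    by rewrite coprimez_sym /coprimez -hm addrC mulrC gcdzMDl -/(coprimez _ _) coprimez_sym.
  by [].
have t_nz (i : nat) : t + d%:Z * i%:Z != 0.
  by rewrite addr_eq0 -mulrN not_dvd.
have n_nz (i : nat) : d%:Z * i.+1%:Z - n%:Z != 0.
  apply: contra_neq (not_dvd (i.+1%:Z - m%:Z)) => h.
  by rewrite mulrBr -[LHS](addrK (d%:Z * m%:Z)) hm; move/subr0_eq: h => ->.
have rhsE : rhs = closed_form d t m / (1 - qF).
  have e2 : qpow ((t * (t - n%:Z)) %/ d%:Z)%Z = (qpow t ^+ m)^-1.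
    have -> : t * (t - n%:Z) = - (t * m%:Z) * d%:Z by rewrite -hm; ring.
    by rewrite mulzK // qpowN qpowM.
  rewrite /rhs e2 /closed_form (qpow_top hm) -(qpowM t 2) [t * 2]mulrC /qint.
  change (qpoch (qpow (2 * t)) (qpow d%:Z) m) with (poch (qpow (2 * t)) (qpow d%:Z) m).
  change (qpoch (qpow d%:Z) (qpow d%:Z) m) with (poch (qpow d%:Z) (qpow d%:Z) m).
  have arrange (F : fieldType) (A B X Z : F) : X * (A / B) * Z = A * X * Z / B by ring.
  exact: arrange.
have sumE (k : nat) : \sum_(i < k) term i - rhs
    = (\sum_(i < k) wterm (qpow t) (qpow d%:Z) i - closed_form d t m) / (1 - qF).
  rewrite rhsE mulrBl mulr_suml; congr (_ - _).
  by apply: eq_bigr => i _; apply: summandE.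
have red (k : nat) :
    (forall e (z : algC), e.-primitive_root z -> (e %| n)%N ->
       has_value z (\sum_(i < k) wterm (qpow t) (qpow d%:Z) i - closed_form d t m) 0) ->
    (forall z : algC, n.-primitive_root z ->
       vanishes n z 3 (\sum_(i < k) wterm (qpow t) (qpow d%:Z) i - closed_form d t m)) ->
    qcong (\sum_(i < k) term i) rhs modulus.
  move=> h1 h3; apply: qcong_of_vanishes n1 _ => e z hz e1 en.
  (* As [e > 1], [z] differs from 1 and the common factor [1 / (1 - q)] is regular at [z]. *)
  have hv_inv : has_value z (1 - qF)^-1 (1 - z)^-1.
    apply: hvV (hvB (hv1 z) (hv_q z)).
    rewrite subr_eq0 eq_sym -[z]expr1 -(prim_order_dvd hz) dvdn1; lia.
  rewrite sumE; apply: vanishesMr hv_inv _.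
  case: (eqVneq e n) => [en'|_]; last exact: (vanishes1 hz (h1 e z hz en)).
  by move: hz; rewrite en'; apply: h3.
have h3 z (hz : n.-primitive_root z) := vanishes_truncated hz d0 co_nd mn hm t_nz n_nz.
split; apply: red.
- by move=> e z hz en; exact: (hv_sub_truncated hz d0 co_nd en hm).
- exact: h3.
- by move=> e z hz en; exact: (hv_sub_full hz d0 co_nd en hm).
move=> z hz.
(* At [e = n] the full sum is the truncated one plus the tail, whose summands all vanish to order
   three. *)
have sum_split l : l = (m.+1 + (n - m.+1))%N ->
  \sum_(k < l) wterm (qpow t) (qpow d%:Z) k
  = \sum_(k < m.+1) wterm (qpow t) (qpow d%:Z) k
    + \sum_(k < n - m.+1) wterm (qpow t) (qpow d%:Z) (m.+1 + k).
  by move=> ->; rewrite big_split_ord.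
rewrite (sum_split n); last by rewrite subnKC.
rewrite addrAC; apply: vanishesD (h3 z hz) _.
apply: vanishes_sum => i _; apply: (vanishes_tail hz d0 co_nd mn hm).
by have := ltn_ord i; lia.
Qed.
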